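(* Let $m$ be normalized Lebesgue measure on the unit circle $\mathbb{T}$, let $M$ be the bilateral shift $(Mf)(\xi)=\xi f(\xi)$ on $L^2(m)$, and let $\phi$ be a unimodular Borel function on $\mathbb{T}$, with multiplication operator $M_\phi f=\phi f$ on $L^2(m)$. Then $M_\phi\in\mathfrak{O}_c(M)$ if and only if the following three conditions are satisfied: (a) $\bar\phi\circ\bar\phi=\operatorname{id}$ almost everywhere on $\mathbb{T}$; (b) $m\circ\bar\phi^{-1}$ is mutually absolutely continuous with respect to $m$; (c) if $h=\dfrac{d(m\circ\bar\phi^{-1})}{dm}$, then $h\cdot(h\circ\bar\phi)=1$ almost everywhere on $\mathbb{T}$.
   Context: A conjugation on a complex Hilbert space is an antilinear, isometric map $C$ with $C^2=I$. For a unitary operator $U$ on a complex Hilbert space $\mathcal{H}$, the conjugate orbit is $\mathfrak{O}_c(U)=\{CUC: C \text{ a conjugation on } \mathcal{H}\}$. Here $\bar\phi:\mathbb{T}\to\mathbb{T}$ is the pointwise complex conjugate of $\phi$, and $m\circ\bar\phi^{-1}$ denotes the Borel measure $\Omega\mapsto m(\bar\phi^{-1}(\Omega))$ on $\mathbb{T}$ ($\bar\phi^{-1}(\Omega)$ is the preimage of $\Omega$ under $\bar\phi$). *)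

(* Defs.v *)
From HB Require Import structures.
From mathcomp Require Import all_boot all_order all_algebra.
From mathcomp Require Import all_classical all_reals all_analysis.
From mathcomp Require Import measurable_realfun complex ring lra.

Set Implicit Arguments.
Unset Strict Implicit.
Unset Printing Implicit Defensive.

Import Order.TTheory GRing.Theory Num.Theory.
Import numFieldNormedType.Exports.

Local Open Scope classical_set_scope.
Local Open Scope ring_scope.
Local Open Scope complex_scope.

HB.instance Definition _ (R : realType) := NormedModule.copy R[i] R[i]^o.

(* R[i] carries its Borel sigma-algebra. *)
HB.instance Definition _ (R : realType) :=
  Measurable.copy R[i] (g_sigma_algebraType (@open R[i])).

Section complex_measurability.
Context {R : realType}.

Lemma normc_ge_Im (z : R[i]) : `|complex.Im z|%:C <= `|z|.
Proof.
have -> : complex.Im z = complex.Re (- (('i%C : R[i]) * z)).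
  by case: z => [a b] /=; rewrite mul0r mul1r sub0r opprK.
apply: le_trans (normc_ge_Re _) _.
rewrite normrN normrM (_ : `|'i%C| = 1) ?mul1r//.
by rewrite normc_def /= expr0n expr1n add0r sqrtr1.
Qed.

Lemma continuous_Re : continuous (@complex.Re R : R[i] -> R).
Proof.
move=> z; apply/(@cvgrPdist_lt _ R _ (nbhs z) (nbhs_filter z)) => e e0.
apply/nbhs_ballP; exists e%:C; first by rewrite /= ltcR.
move=> w; rewrite -ball_normE /ball_ /= => zw.
by rewrite -ltcR -raddfB; apply: le_lt_trans (normc_ge_Re _) zw.
Qed.

Lemma continuous_Im : continuous (@complex.Im R : R[i] -> R).
Proof.
move=> z; apply/(@cvgrPdist_lt _ R _ (nbhs z) (nbhs_filter z)) => e e0.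
apply/nbhs_ballP; exists e%:C; first by rewrite /= ltcR.
move=> w; rewrite -ball_normE /ball_ /= => zw.
by rewrite -ltcR -raddfB; apply: le_lt_trans (normc_ge_Im _) zw.
Qed.

Lemma open_measurable_complex (A : set R[i]) : open A -> measurable A.
Proof. exact: sub_sigma_algebra. Qed.

Lemma continuous_measurable_complex (g : R[i] -> R) :
  continuous g -> measurable_fun setT g.
Proof.
move=> /continuousP cg.
apply: (measurability _ (RGenOpens.measurableE R)).
move=> _ [_ [a [b ->] <-]]; rewrite setTI.
by apply: open_measurable_complex; apply: cg; exact: interval_open.
Qed.

Lemma measurable_Re : measurable_fun setT (@complex.Re R : R[i] -> R).
Proof. by apply: continuous_measurable_complex; exact: continuous_Re. Qed.

Lemma measurable_Im : measurable_fun setT (@complex.Im R : R[i] -> R).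
Proof. by apply: continuous_measurable_complex; exact: continuous_Im. Qed.

Lemma measurable_fun_complexP d (T : measurableType d) (f : T -> R[i]) :
  measurable_fun setT f <->
  measurable_fun setT (@complex.Re R \o f) /\
  measurable_fun setT (@complex.Im R \o f).
Proof.
split=> [mf|[mRe mIm]].
  by split; apply: measurableT_comp => //;
    [exact: measurable_Re|exact: measurable_Im].
apply: (measurability (@open R[i])) => // _ [U oU <-]; rewrite setTI.
pose Q (t : rat * rat * rat) : set R[i] :=
  [set z | `|complex.Re z - ratr t.1.1| < ratr t.2
         /\ `|complex.Im z - ratr t.1.2| < ratr t.2].
have UE : U = \bigcup_(t in [set t | Q t `<=` U]) Q t.
  apply/seteqP; split => [z Uz|z [t /= QU Qz]]; last exact: QU.
  have /nbhs_ballP[e /= e0 eU] : nbhs z U by exact: open_nbhs_nbhs.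
  have eE : e = (complex.Re e)%:C by rewrite RRe_real// gtr0_real.
  rewrite eE in e0 eU; move: (complex.Re e) e0 eU => {eE}{}e.
  rewrite ltcR => e0 eU.
  have e4 : 0 < e / 4 by rewrite divr_gt0.
  have /rat_in_itvoo[r /itvP rP] : 0 < e / 4 by [].
  have r0 : 0 < ratr r :> R by rewrite rP.
  have r4 : ratr r < e / 4 by rewrite rP.
  have /rat_in_itvoo[p /itvP pP] :
      complex.Re z - ratr r < complex.Re z + ratr r.
    by rewrite ltrBlDr -addrA ltrDl addr_gt0.
  have /rat_in_itvoo[q /itvP qP] :
      complex.Im z - ratr r < complex.Im z + ratr r.
    by rewrite ltrBlDr -addrA ltrDl addr_gt0.
  have hp : `|complex.Re z - ratr p| < ratr r.
    by rewrite ltr_distlC !pP.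
  have hq : `|complex.Im z - ratr q| < ratr r.
    by rewrite ltr_distlC !qP.
  exists (p, q, r); last by split.
  move=> w [/= wp wq]; apply: eU; rewrite -ball_normE /ball_ /=.
  have -> : z - w = (complex.Re z - complex.Re w)%:C +
      'i%C * (complex.Im z - complex.Im w)%:C.
    by rewrite -!raddfB -complexE.
  apply: le_lt_trans (ler_normD _ _) _; rewrite normrM.
  have -> : `|'i%C : R[i]| = 1.
    by rewrite normc_def /= expr0n expr1n add0r sqrtr1.
  rewrite mul1r !normc_def/= expr0n/= !addr0 !sqrtr_sqr -rmorphD ltcR.
  have hx (a b c : R) :
      `|a - c| < ratr r -> `|b - c| < ratr r -> `|a - b| < e / 2.
    move=> ac bc; rewrite -(subrKA c) (le_lt_trans (ler_normD _ _))//.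
    have -> : e / 2 = e / 4 + e / 4 by lra.
    by rewrite ltrD// ?(distrC c)// (lt_trans _ r4).
  by rewrite [ltRHS](splitr e) ltrD//;
    [exact: (hx _ _ (ratr p))|exact: (hx _ _ (ratr q))].
rewrite UE preimage_bigcup bigcup_mkcond.
apply: countable_bigcupT_measurable; first exact: countableP.
move=> t; case: ifPn => // _.
rewrite [X in measurable X](_ : _ =
  (@complex.Re R \o f) @^-1` (ball (ratr t.1.1 : R) (ratr t.2)) `&`
  (@complex.Im R \o f) @^-1` (ball (ratr t.1.2 : R) (ratr t.2))); last first.
  by rewrite /Q -!ball_normE/=; apply/seteqP; split=> x /=;
    rewrite !(distrC (ratr _)).
apply: measurableI; rewrite -[X in measurable X]setTI.
  by apply: mRe => //; exact: measurable_ball.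
by apply: mIm => //; exact: measurable_ball.
Qed.
End complex_measurability.

Section measurable_complex_operations.
Context d {T : measurableType d} {R : realType}.
Implicit Types f g : T -> R[i].

Lemma measurable_funD_complex f g : measurable_fun setT f ->
  measurable_fun setT g -> measurable_fun setT (f \+ g).
Proof.
move=> /measurable_fun_complexP[fR fI] /measurable_fun_complexP[gR gI].
apply/measurable_fun_complexP; split.
  rewrite (_ : _ \o _ = (@complex.Re R \o f) \+ (@complex.Re R \o g)).
    exact: measurable_funD.
  by apply/funext => x /=; rewrite raddfD.
rewrite (_ : _ \o _ = (@complex.Im R \o f) \+ (@complex.Im R \o g)).
  exact: measurable_funD.
by apply/funext => x /=; rewrite raddfD.
Qed.

Lemma measurable_funM_complex f g : measurable_fun setT f ->
  measurable_fun setT g -> measurable_fun setT (f \* g).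
Proof.
move=> /measurable_fun_complexP[fR fI] /measurable_fun_complexP[gR gI].
apply/measurable_fun_complexP; split.
  rewrite (_ : _ \o _ = ((@complex.Re R \o f) \* (@complex.Re R \o g))
      \- ((@complex.Im R \o f) \* (@complex.Im R \o g))).
    by apply: measurable_funB; exact: measurable_funM.
  by apply/funext => x /=; case: (f x) (g x) => [a b] [a' b'].
rewrite (_ : _ \o _ = ((@complex.Re R \o f) \* (@complex.Im R \o g))
    \+ ((@complex.Im R \o f) \* (@complex.Re R \o g))).
  by apply: measurable_funD; exact: measurable_funM.
by apply/funext => x /=; case: (f x) (g x) => [a b] [a' b'].
Qed.

Lemma measurable_normc f : measurable_fun setT f ->
  measurable_fun setT (fun x => Normc.normc (f x)).
Proof.
move=> /measurable_fun_complexP[fR fI].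
rewrite (_ : (fun _ => _) = Num.sqrt \o
    (fun x => (complex.Re (f x)) ^+ 2 + (complex.Im (f x)) ^+ 2)).
  apply: measurableT_comp => //.
    exact: continuous_measurable_fun (@sqrt_continuous R).
  by apply: measurable_funD; exact: measurable_funX.
by apply/funext => x /=; case: (f x).
Qed.

End measurable_complex_operations.

Section L2_space.
Context d {T : measurableType d} {R : realType}.
Variable mu : {measure set T -> \bar R}.
Implicit Types f g : T -> R[i].

Definition eL2norm f : \bar R :=
  ('N[mu]_2%:E[(fun x => (Normc.normc (f x))%:E)])%E.

(* The quotient by a.e. equality is the one of {mfun_ mu, T >-> R[i]}; applying
   an element of [L2] to a point uses a chosen representative, so that values
   are only meaningful up to a.e. equality. *)
Record L2 := MkL2 {
  L2_fun :> {mfun_ mu, T >-> R[i]} ;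
  L2_finite : (eL2norm L2_fun < +oo)%E }.

HB.instance Definition _ := [isSub for L2_fun].
HB.instance Definition _ := [Choice of L2 by <:].

Lemma normc_ge0 (z : R[i]) : 0 <= Normc.normc z.
Proof. by case: z => a b; exact: sqrtr_ge0. Qed.

Lemma eL2normE f :
  eL2norm f = ((\int[mu]_x ((Normc.normc (f x)) ^+ 2)%:E) `^ 2^-1)%E.
Proof.
rewrite /eL2norm unlock; congr (_ `^ _)%E; apply: eq_integral => x _.
by rewrite abse_EFin poweR_EFin powR_mulrn// ger0_norm// normc_ge0.
Qed.

Lemma eL2norm_ge0 f : (0 <= eL2norm f)%E.
Proof. exact: Lnorm_ge0. Qed.

Lemma eL2norm_le f g : measurable_fun setT f -> measurable_fun setT g ->
  {ae mu, forall x, Normc.normc (f x) <= Normc.normc (g x)} ->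
  (eL2norm f <= eL2norm g)%E.
Proof.
move=> mf mg fg; rewrite !eL2normE.
have mp h : measurable_fun setT h ->
    measurable_fun setT (fun x : T => ((Normc.normc (h x)) ^+ 2)%:E).
  by move=> mh; apply/measurable_EFinP/measurable_funX; exact: measurable_normc.
have p0 h x : (0 <= ((Normc.normc (h x)) ^+ 2)%:E)%E by rewrite lee_fin sqr_ge0.
apply: gt0_ler_poweR; rewrite ?invr_ge0// ?in_itv/= ?andbT ?leey ?integral_ge0//.
- by move=> x _; exact: p0.
- by move=> x _; exact: p0.
apply: ae_ge0_le_integral => //.
- by move=> x _; exact: p0.
- exact: mp.
- by move=> x _; exact: p0.
- exact: mp.
by apply: filterS fg => x fgx _; rewrite lee_fin ler_sqr// nnegrE normc_ge0.
Qed.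

Lemma eL2norm_ae_eq f g : measurable_fun setT f -> measurable_fun setT g ->
  f = g %[ae mu] -> eL2norm f = eL2norm g.
Proof.
move=> mf mg fg; apply/eqP; rewrite eq_le !eL2norm_le//.
  by apply: filterS fg => x ->.
by apply: filterS fg => x ->.
Qed.

Lemma eL2normD f g : measurable_fun setT f -> measurable_fun setT g ->
  (eL2norm (f \+ g)%R <= eL2norm f + eL2norm g)%E.
Proof.
move=> mf mg.
have mn := measurable_normc.
apply: le_trans (eminkowski mu (mn _ _ _ _ mf) (mn _ _ _ _ mg) _); last first.
  by rewrite lee1n.
rewrite /eL2norm.
pose h x : R[i] := (Normc.normc (f x) + Normc.normc (g x))%:C.
have hE x : Normc.normc (h x) = Normc.normc (f x) + Normc.normc (g x).
  by rewrite /h /= expr0n addr0 sqrtr_sqr ger0_norm// addr_ge0// normc_ge0.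
rewrite [leRHS](_ : _ = eL2norm h); last first.
  by apply: eq_Lnorm => x; rewrite hE.
apply: eL2norm_le.
- exact: measurable_funD_complex.
- apply/measurable_fun_complexP; split; last exact: measurable_cst.
  by apply: measurable_funD; exact: mn.
- by apply: aeW => x; rewrite hE; exact: le_normcD.
Qed.

Lemma eL2normZ (a : R[i]) f : measurable_fun setT f ->
  eL2norm (fun x => a * f x) = ((Normc.normc a)%:E * eL2norm f)%E.
Proof.
move=> mf; rewrite !eL2normE.
under eq_integral do rewrite Normc.normcM exprMn EFinM.
rewrite ge0_integralZl//; last 3 first.
- by apply/measurable_EFinP/measurable_funX; exact: measurable_normc.
- by move=> x _; rewrite lee_fin sqr_ge0.
- by rewrite lee_fin sqr_ge0.
rewrite poweRM ?lee_fin ?sqr_ge0 ?integral_ge0//; last first.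
  by move=> x _; rewrite lee_fin sqr_ge0.
congr (_ * _)%E; rewrite poweR_EFin -powR_mulrn ?normc_ge0//.
by rewrite -powRrM divff// powRr1// normc_ge0.
Qed.

Lemma eL2norm_eq0 f : measurable_fun setT f -> eL2norm f = 0%E ->
  f = cst 0 %[ae mu].
Proof.
move=> mf /Lnorm_eq0_eq0 H.
have : measurable_fun setT (fun x => (Normc.normc (f x))%:E).
  by apply/measurable_EFinP; exact: measurable_normc.
move=> /H /(_ ltac:(by [])); apply: filterS => x /= /(_ I) [+] _.
exact: Normc.eq0_normc.
Qed.

Lemma measurable_L2 (f : L2) : measurable_fun setT f.
Proof. exact: measurable_funPT. Qed.

Lemma L2P (u v : L2) : u = v <-> u = v %[ae mu].
Proof.
split=> [->|uv]; first exact: ae_eq_refl.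
apply: val_inj => /=; rewrite -[LHS]reprK -[RHS]reprK.
by apply/eqP; rewrite eqmodE; exact/asboolP.
Qed.

Definition mfun_of f (mf : measurable_fun setT f) : {mfun T >-> R[i]} :=
  HB.pack_for {mfun T >-> R[i]} f (isMeasurableFun.Build _ _ _ _ f mf).

Definition L2_class f (mf : measurable_fun setT f) : {mfun_ mu, T >-> R[i]} :=
  \pi%qT (mfun_of mf).

Lemma L2_classE f (mf : measurable_fun setT f) : L2_class mf = f %[ae mu].
Proof.
have : \pi_({mfun_ mu, T >-> R[i]})%qT (repr (L2_class mf)) =
    \pi%qT (mfun_of mf).
  by rewrite reprK.
by move=> /eqquotP/asboolP.
Qed.

Lemma L2_class_finite f (mf : measurable_fun setT f) :
  (eL2norm f < +oo)%E -> (eL2norm (L2_class mf) < +oo)%E.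
Proof.
by rewrite -(eL2norm_ae_eq _ mf (L2_classE mf))//; exact: measurable_funPT.
Qed.

Definition toL2 f (mf : measurable_fun setT f)
    (foo : (eL2norm f < +oo)%E) : L2 :=
  MkL2 (L2_class_finite mf foo).

Lemma toL2E f mf foo : @toL2 f mf foo = f %[ae mu].
Proof. exact: L2_classE. Qed.

Let zero_finite : (eL2norm (fun=> 0%R) < +oo)%E.
Proof.
rewrite /eL2norm (_ : (fun _ => _) = cst 0%E) ?Lnorm0//.
by apply/funext => x; rewrite Normc.normc0.
Qed.

Let add_finite (u v : L2) : (eL2norm (fun x => (u x + v x)%R) < +oo)%E.
Proof.
apply: le_lt_trans (eL2normD (measurable_L2 u) (measurable_L2 v)) _.
by rewrite lte_add_pinfty// L2_finite.
Qed.

Let add_measurable (u v : L2) : measurable_fun setT (fun x => u x + v x).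
Proof. exact: measurable_funD_complex (measurable_L2 u) (measurable_L2 v). Qed.

Let scale_finite (a : R[i]) (u : L2) : (eL2norm (fun x => (a * u x)%R) < +oo)%E.
Proof.
rewrite eL2normZ; last exact: measurable_L2.
rewrite lte_mul_pinfty ?lee_fin ?normc_ge0//; exact: L2_finite.
Qed.

Let scale_measurable (a : R[i]) (u : L2) :
  measurable_fun setT (fun x => a * u x).
Proof. by apply: measurable_funM_complex => //; exact: measurable_L2. Qed.

Definition zeroL2 : L2 := toL2 (measurable_cst (0 : R[i])) zero_finite.
Definition addL2 (u v : L2) : L2 := toL2 (add_measurable u v) (add_finite u v).
Definition scaleL2 (a : R[i]) (u : L2) : L2 :=
  toL2 (scale_measurable a u) (scale_finite a u).
Definition oppL2 (u : L2) : L2 := scaleL2 (- 1) u.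

Let zeroE : zeroL2 = cst 0 %[ae mu].
Proof. exact: toL2E. Qed.

Let addE u v : addL2 u v = (fun x => u x + v x) %[ae mu].
Proof. exact: toL2E. Qed.

Let scaleE a u : scaleL2 a u = (fun x => a * u x) %[ae mu].
Proof. exact: toL2E. Qed.

Let addA : associative addL2.
Proof.
move=> u v w; apply/L2P.
apply: filterS (filterI (filterI (addE u (addL2 v w)) (addE v w))
  (filterI (addE (addL2 u v) w) (addE u v))) => x [[e1 e2] [e3 e4]] _.
by rewrite e1// e2// e3// e4// addrA.
Qed.

Let addC : commutative addL2.
Proof.
move=> u v; apply/L2P; apply: filterS2 (addE u v) (addE v u).
by move=> x + + _ => -> // -> //; rewrite addrC.
Qed.

Let add0 : left_id zeroL2 addL2.
Proof.
move=> u; apply/L2P; apply: filterS2 (addE zeroL2 u) zeroE.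
by move=> x + + _ => -> // -> //; rewrite add0r.
Qed.

Let addN : left_inverse zeroL2 oppL2 addL2.
Proof.
move=> u; apply/L2P; apply: filterS3 (addE (oppL2 u) u) (scaleE (- 1) u) zeroE.
by move=> x + + + _ => -> // -> // -> //; rewrite mulN1r addNr.
Qed.

HB.instance Definition _ := GRing.isZmodule.Build L2 addA addC add0 addN.

Let scaleA a b u : scaleL2 a (scaleL2 b u) = scaleL2 (a * b) u.
Proof.
apply/L2P; apply: filterS3 (scaleE a (scaleL2 b u)) (scaleE b u)
  (scaleE (a * b) u).
by move=> x + + + _ => -> // -> // -> //; rewrite mulrA.
Qed.

Let scale1 : left_id 1 scaleL2.
Proof.
move=> u; apply/L2P; apply: filterS (scaleE 1 u).
by move=> x + _ => -> //; rewrite mul1r.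
Qed.

Let scaleDr : right_distributive scaleL2 +%R.
Proof.
move=> a u v; apply/L2P.
apply: filterS (filterI (filterI (scaleE a (addL2 u v)) (addE u v))
  (filterI (addE (scaleL2 a u) (scaleL2 a v))
    (filterI (scaleE a u) (scaleE a v)))) => x [[e1 e2] [e3 [e4 e5]]] _.
by rewrite e1// e2// e3// e4// e5// mulrDr.
Qed.

Let scaleDl u : {morph scaleL2^~ u : a b / a + b}.
Proof.
move=> a b; apply/L2P.
apply: filterS (filterI (filterI (scaleE (a + b) u)
  (addE (scaleL2 a u) (scaleL2 b u)))
  (filterI (scaleE a u) (scaleE b u))) => x [[e1 e2] [e3 e4]] _.
by rewrite e1// e2// e3// e4// mulrDl.
Qed.

HB.instance Definition _ := GRing.Zmodule_isLmodule.Build R[i] L2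
  scaleA scale1 scaleDr scaleDl.

Definition L2norm (u : L2) : R[i] := (fine (eL2norm u))%:C.

Let normE (u : L2) : (fine (eL2norm u))%:E = eL2norm u.
Proof.
by rewrite fineK// ge0_fin_numE ?eL2norm_ge0// L2_finite.
Qed.

Let normD (u v : L2) : L2norm (u + v) <= L2norm u + L2norm v.
Proof.
rewrite /L2norm -rmorphD lecR -lee_fin EFinD !normE.
apply: le_trans (eL2normD (measurable_L2 u) (measurable_L2 v)).
rewrite le_eqVlt; apply/orP; left; apply/eqP.
by apply: eL2norm_ae_eq; [exact: measurable_L2|
  exact: add_measurable|exact: addE].
Qed.

Let normZ (a : R[i]) (u : L2) : L2norm (a *: u) = `|a| * L2norm u.
Proof.
rewrite /L2norm (normc_def a) -rmorphM; congr (_ %:C).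
apply: EFin_inj; rewrite EFinM !normE.
rewrite (_ : Num.sqrt _ = Normc.normc a); last by case: (a).
rewrite -eL2normZ; last exact: measurable_L2.
by apply: eL2norm_ae_eq; [exact: measurable_L2|
  exact: scale_measurable|exact: scaleE].
Qed.

Let norm0 (u : L2) : L2norm u = 0 -> u = 0.
Proof.
move=> /(@complexI R) /(congr1 (@EFin R)); rewrite normE => u0; apply/L2P.
apply: filterS2 (eL2norm_eq0 (measurable_L2 u) u0) zeroE.
by move=> x e0 e1 _; rewrite e0// e1.
Qed.

HB.instance Definition _ := Lmodule_isNormed.Build R[i] L2 normD normZ norm0.

End L2_space.

(* Hilbert spaces enter these two notions only through their linear structure
   and their norm; [L2 mu] is a normed module over R[i]. *)
Definition conjugation (R : realType) (H : normedModType R[i]) (C : H -> H) :=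
  [/\ forall (a : R[i]) (x y : H), C (a *: x + y) = a^* *: C x + C y,
      forall x : H, `|C x| = `|x|
    & forall x : H, C (C x) = x].

Definition conjugate_orbit (R : realType) (H : normedModType R[i])
    (U : H -> H) : set (H -> H) :=
  [set C \o U \o C | C in @conjugation R H].

Definition circle (R : realType) : Type := [set z : R[i] | `|z| = 1].

(* Subspace topology, then its Borel sigma-algebra. *)
HB.instance Definition _ (R : realType) := Topological.on (circle R).

Section circle.
Context {R : realType}.

Definition circle_val (x : circle R) : R[i] := set_val x.

Coercion circle_val : circle >-> complex.

Lemma normr_circle (x : circle R) : `|x : R[i]| = 1.
Proof. by have := set_mem (valP x). Qed.

Lemma circle_val_inj : injective circle_val.
Proof. exact: val_inj. Qed.

Definition to_circle (z : R[i]) (z1 : `|z| = 1) : circle R :=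
  SigSub (mem_set z1).

Lemma to_circleK z z1 : @to_circle z z1 = z :> R[i].
Proof. by []. Qed.

HB.instance Definition _ := isPointed.Build (circle R)
  (to_circle (@normr1 R[i])).

HB.instance Definition _ :=
  Measurable.copy (circle R) (g_sigma_algebraType (@open (circle R))).

Lemma measurable_circle_val : measurable_fun setT circle_val.
Proof.
apply: (measurability (@open R[i])) => // _ [A oA <-]; rewrite setTI.
by apply: sub_sigma_algebra; exists A.
Qed.

Lemma measurable_fun_circleP d (T : measurableType d) (f : T -> circle R) :
  measurable_fun setT f <-> measurable_fun setT (circle_val \o f).
Proof.
split=> [mf|mf].
  by apply: measurableT_comp => //; exact: measurable_circle_val.
apply: (measurability (@open (circle R))) => // _ [_ [A oA <-] <-].
rewrite setTI -comp_preimage -[X in measurable X]setTI; apply: mf => //.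
exact: open_measurable_complex.
Qed.

Lemma circle_exp_subproof (t : R) :
  `|cos (2 * pi * t) +i* sin (2 * pi * t)| = 1.
Proof. by rewrite normc_def/= cos2Dsin2 sqrtr1. Qed.

Definition circle_exp (t : measurableTypeR R) : circle R :=
  to_circle (circle_exp_subproof t).

Lemma measurable_circle_exp : measurable_fun setT circle_exp.
Proof.
apply/measurable_fun_circleP/measurable_fun_complexP.
have m2 : measurable_fun setT (fun t : measurableTypeR R => (2 * pi * t : R)).
  by exact: measurable_funM.
split.
- apply: (measurableT_comp _ m2); apply: continuous_measurable_fun.
  exact: continuous_cos.
- apply: (measurableT_comp _ m2); apply: continuous_measurable_fun.
  exact: continuous_sin.
Qed.

HB.instance Definition _ :=
  isMeasurableFun.Build _ _ _ _ circle_exp measurable_circle_exp.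

(* Normalized Lebesgue measure on the circle is the image of Lebesgue measure on
   [0, 1] under t |-> e^{2 i pi t}. *)
Definition unit_lebesgue : set (measurableTypeR R) -> \bar R :=
  mrestr (@lebesgue_measure R) (measurable_itv `[0, 1]).

HB.instance Definition _ := Measure.on unit_lebesgue.

Let unit_lebesgue_setT : unit_lebesgue setT = 1%E.
Proof.
rewrite /unit_lebesgue /mrestr setTI.
by rewrite lebesgue_measure_itv/= lte01 oppr0 adde0.
Qed.

HB.instance Definition _ :=
  Measure_isProbability.Build _ _ _ unit_lebesgue unit_lebesgue_setT.

Definition circle_lebesgue : set (circle R) -> \bar R :=
  distribution unit_lebesgue circle_exp.

HB.instance Definition _ := Probability.on circle_lebesgue.

Lemma circle_conj_subproof (x : circle R) : `|(x : R[i])^*| = 1.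
Proof. by rewrite normcJ normr_circle. Qed.

Definition circle_conj (x : circle R) : circle R :=
  to_circle (circle_conj_subproof x).

Lemma measurable_circle_conj : measurable_fun setT circle_conj.
Proof.
apply/measurable_fun_circleP.
have /measurable_fun_complexP[mR mI] := measurable_circle_val.
apply/measurable_fun_complexP; split.
  rewrite (_ : _ \o _ = @complex.Re R \o circle_val)//.
  by apply/funext => x /=; rewrite to_circleK; case: (circle_val x).
rewrite (_ : _ \o _ = \- (@complex.Im R \o circle_val)).
  exact: measurable_funN.
by apply/funext => x /=; rewrite to_circleK; case: (circle_val x).
Qed.

HB.instance Definition _ :=
  isMeasurableFun.Build _ _ _ _ circle_conj measurable_circle_conj.

End circle.

Section multiplication_operator.
Context {R : realType} d {T : measurableType d}.
Variables (mu : {measure set T -> \bar R}) (phi : {mfun T >-> circle R}).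

Let mul_measurable (f : L2 mu) :
  measurable_fun setT (fun x => circle_val (phi x) * f x).
Proof.
apply: measurable_funM_complex; last exact: measurable_L2.
by apply/measurable_fun_circleP; exact: measurable_funPT.
Qed.

Let mul_finite (f : L2 mu) :
  (eL2norm mu (fun x => (circle_val (phi x) * f x)%R) < +oo)%E.
Proof.
rewrite (_ : eL2norm _ _ = eL2norm mu f); last first.
  apply: eq_Lnorm => x; rewrite Normc.normcM.
  rewrite (_ : Normc.normc (circle_val (phi x)) = 1) ?mul1r//.
  have := normr_circle (phi x); rewrite normc_def.
  by case: (circle_val _) => a b [].
exact: L2_finite.
Qed.

Definition mulop (f : L2 mu) : L2 mu := toL2 (mul_measurable f) (mul_finite f).

Lemma mulopE f : mulop f = (fun x => circle_val (phi x) * f x) %[ae mu].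
Proof. exact: toL2E. Qed.

End multiplication_operator.
Arguments mulop {R d T} mu phi f.

HB.instance Definition _ d (T : measurableType d) :=
  isMeasurableFun.Build _ _ _ _ (@idfun T) (@measurable_id _ T setT).

Definition bilateral_shift (R : realType) :
    L2 (@circle_lebesgue R) -> L2 (@circle_lebesgue R) :=
  mulop (@circle_lebesgue R) (idfun : {mfun circle R >-> circle R}).

(* Main.v *)
(* Write [tau] for the conjugate of [phi].  If C is a conjugation with
   CMC = M_phi, then C intertwines multiplication by a real function g with
   multiplication by [g \o tau] for g = Re and g = Im.  The functions g with this
   property form an algebra closed under bounded pointwise limits, so they
   include the indicator of every Borel set A.  Applying C twice to the indicator
   of A gives that [tau \o tau] preserves A up to a null set, hence (a), and
   applying it to null sets gives (b).  Condition (c) follows from (a) and (b) by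
   the change of variables x = tau y.  Conversely, under (a) and (b) the
   map f |-> sqrt h * conj (f \o tau) is a conjugation sending M to M_phi. *)

Require Import Defs.
From mathcomp Require Import all_boot all_order all_algebra.
From mathcomp Require Import all_classical all_reals all_analysis.
From mathcomp Require Import measurable_realfun complex ring lra.

Set Implicit Arguments.
Unset Strict Implicit.
Unset Printing Implicit Defensive.

Import Order.TTheory GRing.Theory Num.Theory.
Import numFieldNormedType.Exports.

Local Open Scope classical_set_scope.
Local Open Scope ring_scope.
Local Open Scope charge_scope.

(** * Squared $L^2$ norms and multiplication by bounded real functions *)

Section energy.
Context d {T : measurableType d} {R : realType}.
Variable mu : {measure set T -> \bar R}.
Implicit Types (f g : T -> R[i]) (u v : L2 mu).

(** The square of [eL2norm], kept as an extended real so that monotone and dominated convergence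
    results apply without a root. *)
Definition energy f : \bar R := (\int[mu]_x ((Normc.normc (f x)) ^+ 2)%:E)%E.

Lemma measurable_normc2 f : measurable_fun setT f ->
  measurable_fun setT (fun x => ((Normc.normc (f x)) ^+ 2)%:E).
Proof.
by move=> mf; apply/measurable_EFinP/measurable_funX; exact: measurable_normc.
Qed.

Lemma energy_ge0 f : (0 <= energy f)%E.
Proof. by apply: integral_ge0 => x _; rewrite lee_fin sqr_ge0. Qed.

Lemma energyE f : energy f = (eL2norm mu f `^ 2)%E.
Proof. by rewrite eL2normE -poweRrM mulVf// poweRe1// energy_ge0. Qed.

Lemma energy_L2_lty u : (energy u < +oo)%E.
Proof. by rewrite energyE poweR_lty// L2_finite. Qed.

Lemma energy_ae_eq f g : measurable_fun setT f -> measurable_fun setT g ->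
  f = g %[ae mu] -> energy f = energy g.
Proof. by move=> mf mg fg; rewrite !energyE (eL2norm_ae_eq mf mg fg). Qed.

Lemma energy_eq0 f : measurable_fun setT f -> energy f = 0%E ->
  f = cst 0 %[ae mu].
Proof.
move=> mf; rewrite energyE => /(poweR_eq0_eq0 (eL2norm_ge0 mu f)).
exact: eL2norm_eq0.
Qed.

Lemma le_energy f g : measurable_fun setT f -> measurable_fun setT g ->
  (forall x, Normc.normc (f x) <= Normc.normc (g x)) -> (energy f <= energy g)%E.
Proof.
move=> mf mg fg; apply: ge0_le_integral => //.
- by move=> x _; rewrite lee_fin sqr_ge0.
- exact: measurable_normc2.
- exact: measurable_normc2.
- by move=> x _; rewrite lee_fin lerXn2r ?nnegrE ?normc_ge0.
Qed.

Lemma energyZ (a : R) f : measurable_fun setT f ->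
  energy (fun x => a%:C%C * f x) = ((a ^+ 2)%:E * energy f)%E.
Proof.
move=> mf; rewrite /energy -ge0_integralZl//.
- apply: eq_integral => x _; rewrite Normc.normcM exprMn EFinM.
  congr (_%:E * _)%E.
  by rewrite /= expr0n/= addr0 sqrtr_sqr real_normK// num_real.
- exact: measurable_normc2.
- by move=> x _; rewrite lee_fin sqr_ge0.
- by rewrite lee_fin sqr_ge0.
Qed.

(** Stands in for the triangle inequality at the level of squares: $(a+b)^2 \le 2a^2+2b^2$ because
    $(a-b)^2 \ge 0$. *)
Lemma energyD f g : measurable_fun setT f -> measurable_fun setT g ->
  (energy (f \+ g)%R <= 2%:E * energy f + 2%:E * energy g)%E.
Proof.
move=> mf mg.
rewrite /energy -!ge0_integralZl//; last 4 first.
- exact: measurable_normc2.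
- by move=> x _; rewrite lee_fin sqr_ge0.
- exact: measurable_normc2.
- by move=> x _; rewrite lee_fin sqr_ge0.
rewrite -ge0_integralD//; last 4 first.
- by move=> x _; rewrite -EFinM lee_fin mulr_ge0// sqr_ge0.
- by apply: measurable_funeM; exact: measurable_normc2.
- by move=> x _; rewrite -EFinM lee_fin mulr_ge0// sqr_ge0.
- by apply: measurable_funeM; exact: measurable_normc2.
apply: ge0_le_integral => //.
- by move=> x _; rewrite lee_fin sqr_ge0.
- by apply: measurable_normc2; exact: measurable_funD_complex.
- by apply: emeasurable_funD; apply: measurable_funeM; exact: measurable_normc2.
move=> x _; rewrite -!EFinM -EFinD lee_fin.
have := le_normcD (f x) (g x).
have := normc_ge0 (f x); have := normc_ge0 (g x); have := normc_ge0 (f x + g x).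
rewrite /=; move: (Normc.normc _) (Normc.normc _) (Normc.normc _) => a b c.
move=> c0 b0 a0 cab.
have : c ^+ 2 <= (a + b) ^+ 2 by rewrite lerXn2r ?nnegrE ?addr_ge0.
by have := sqr_ge0 (a - b); lra.
Qed.

Lemma L2_norm_eq u v : `|u| = `|v| <-> energy u = energy v.
Proof.
have fE (w : L2 mu) : (fine (eL2norm mu w))%:E = eL2norm mu w.
  by rewrite fineK// ge0_fin_numE ?eL2norm_ge0// L2_finite.
split=> [/(@complexI R)/(congr1 (@EFin R))|].
  by rewrite !fE !energyE => ->.
by rewrite /energy => uv; congr (_ %:C)%C; rewrite !eL2normE uv.
Qed.

Lemma toL2_exists f : measurable_fun setT f -> (energy f < +oo)%E ->
  exists u, u = f %[ae mu].
Proof.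
move=> mf fy; have nf : (eL2norm mu f < +oo)%E.
  by rewrite eL2normE poweR_lty.
by exists (toL2 mf nf); exact: toL2E.
Qed.

Lemma L2_addE u v : (u + v : L2 mu) = (fun x => u x + v x) %[ae mu].
Proof. exact: toL2E. Qed.

Lemma L2_scaleE a u : (a *: u : L2 mu) = (fun x => a * u x) %[ae mu].
Proof. exact: toL2E. Qed.

Lemma L2_zeroE : (0 : L2 mu) = cst 0 %[ae mu].
Proof. exact: toL2E. Qed.

Lemma measurable_real_complex (g : T -> R) : measurable_fun setT g ->
  measurable_fun setT (fun x => (g x)%:C%C).
Proof.
move=> mg; apply/measurable_fun_complexP.
by split; [exact: mg|exact: measurable_cst].
Qed.

Lemma measurable_real_mul (g : T -> R) f : measurable_fun setT g ->
  measurable_fun setT f -> measurable_fun setT (fun x => (g x)%:C%C * f x).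
Proof.
by move=> mg mf; apply: measurable_funM_complex => //; exact: measurable_real_complex.
Qed.

Lemma normc_real (a : R) : Normc.normc (a%:C)%C = `|a|.
Proof. by rewrite /= expr0n/= addr0 sqrtr_sqr. Qed.

Lemma bounded_mul_L2 (g : T -> R) (M : R) u : measurable_fun setT g ->
  (forall x, `|g x| <= M) -> exists v, v = (fun x => (g x)%:C%C * u x) %[ae mu].
Proof.
move=> mg gM; have mu_ := measurable_L2 u.
apply: toL2_exists; first exact: measurable_real_mul.
apply: (@le_lt_trans _ _ (energy (fun x => M%:C%C * u x))).
  apply: le_energy => [||x].
  - exact: measurable_real_mul.
  - exact: (@measurable_real_mul (cst M)).
  - rewrite !Normc.normcM !normc_real ler_wpM2r ?normc_ge0//.
    by rewrite (le_trans (gM x))// ler_norm.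
rewrite energyZ// lte_mul_pinfty ?lee_fin ?sqr_ge0//; exact: energy_L2_lty.
Qed.

Lemma bounded_cvg_energy (g_ : nat -> T -> R) (g : T -> R) u :
  (forall n, measurable_fun setT (g_ n)) -> measurable_fun setT g ->
  (forall n x, `|g_ n x| <= 1) -> (forall x, `|g x| <= 1) ->
  (forall x, g_ n x @[n --> \oo] --> g x) ->
  energy (fun x => (g_ n x - g x)%:C%C * u x) @[n --> \oo] --> 0%E.
Proof.
move=> mg_ mg g_1 g1 gg; have mu_ := measurable_L2 u.
pose G n x : R[i] := (g_ n x - g x)%:C%C * u x.
pose F n x := ((Normc.normc (G n x)) ^+ 2)%:E.
have FE n x : F n x = ((g_ n x - g x) ^+ 2 * (Normc.normc (u x)) ^+ 2)%:E.
  by rewrite /F /G Normc.normcM normc_real exprMn real_normK// num_real.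
(* The dominating function is $4|u|^2$, since $|g_n - g| \le 2$. *)
have [] := @dominated_convergence _ _ _ mu setT measurableT F (cst 0%E)
    (fun x => (4%:E * ((Normc.normc (u x)) ^+ 2)%:E)%E).
- move=> n; apply: measurable_normc2; apply: measurable_real_mul => //.
  exact: measurable_funB.
- exact: measurable_cst.
- apply: aeW => x _; rewrite [X in X @ _](_ : _ =
    (fun n => ((g_ n x - g x) ^+ 2 * (Normc.normc (u x)) ^+ 2)%:E)); last first.
    by apply/funext => n; rewrite FE.
  apply: cvg_EFin; first exact: nearW.
  rewrite [X in _ --> X](_ : _ = (g x - g x) ^+ 2 * Normc.normc (u x) ^+ 2);
    last by rewrite subrr expr0n mul0r.
  apply: cvgM; last exact: cvg_cst.
  apply: (@cvgM _ _ _ _ (fun n => g_ n x - g x) (fun n => g_ n x - g x));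
    by apply: cvgB; [exact: gg|exact: cvg_cst].
- apply: integrableZl => //; apply/integrableP.
  split; first exact: measurable_normc2.
  have := energy_L2_lty u; rewrite /energy; congr (_ < _)%E.
  by apply: eq_integral => x _; rewrite gee0_abs// lee_fin sqr_ge0.
- apply: aeW => x n _; rewrite FE -EFinM gee0_abs lee_fin;
    last exact: mulr_ge0 (sqr_ge0 _) (sqr_ge0 _).
  apply: ler_wpM2r; first exact: sqr_ge0.
  have : `|g_ n x - g x| <= 2.
    by rewrite (le_trans (ler_normB _ _))// (_ : 2 = 1 + 1)// lerD.
  by rewrite ler_norml => /andP[]; move: (_ - _) => a; nra.
move=> _ _; rewrite integral_cst// mul0e; exact.
Qed.

End energy.

(** * Polynomial approximation of the sign function on $[-1,1]$ *)

Section sign_iteration.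
Context {R : realType}.
Implicit Types x : R.

(* Newton-Schulz iteration: a polynomial map of [-1, 1] to itself whose
   iterates converge pointwise to the sign function. *)
Definition sign_step x := x * (3 - x ^+ 2) / 2.

Lemma sign_step_bound x : `|x| <= 1 -> `|sign_step x| <= 1.
Proof.
rewrite !ler_norml /sign_step => /andP[x0 x1].
(* With $s$ for [sign_step], these products are $2(1-s(x))$ and $2(1+s(x))$. *)
have h1 : 0 <= (1 - x) ^+ 2 * (2 + x) by rewrite mulr_ge0 ?sqr_ge0//; lra.
have h2 : 0 <= (1 + x) ^+ 2 * (2 - x) by rewrite mulr_ge0 ?sqr_ge0//; lra.
by apply/andP; split; lra.
Qed.

Lemma iter_sign_step_bound n x : `|x| <= 1 -> `|iter n sign_step x| <= 1.
Proof. by move=> x1; elim: n => //= n; exact: sign_step_bound. Qed.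

Lemma iter_sign_stepN n x : iter n sign_step (- x) = - iter n sign_step x.
Proof.
by elim: n => //= n ->; rewrite /sign_step sqrrN !mulNr.
Qed.

(** The error satisfies $1-s(y) = (1-y)(1-(y+y^2)/2)$. Iterates started at $x$ stay in $[x,1]$, so
    each step shrinks the error by at least the factor $r = 1-(x+x^2)/2 < 1$. *)
Lemma cvg_sign_step_gt0 x : 0 < x -> x <= 1 ->
  iter n sign_step x @[n --> \oo] --> (1 : R).
Proof.
move=> x0 x1; pose r : R := 1 - (x + x ^+ 2) / 2.
have x2 : x ^+ 2 <= x by rewrite expr2 ler_piMl// ltW.
have x20 : 0 < x ^+ 2 by rewrite exprn_gt0.
have r0 : 0 <= r by rewrite /r; lra.
have r1 : r < 1 by rewrite /r; lra.
have itP n : x <= iter n sign_step x <= 1 /\ 1 - iter n sign_step x <= r ^+ n.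
  elim: n => [|n [/andP[xn n1] IH]]/=.
    by rewrite lexx x1 expr0 lerBlDr lerDl ltW.
  move: (iter n _ _) xn n1 IH => y xy y1 IH.
  have y0 : 0 < y := lt_le_trans x0 xy.
  have sE : 1 - sign_step y = (1 - y) * (1 - (y + y ^+ 2) / 2).
    by rewrite /sign_step; field.
  have y2 : y ^+ 2 <= y by rewrite expr2 ler_piMl// ltW.
  have xy2 : x ^+ 2 <= y ^+ 2 by rewrite lerXn2r ?nnegrE//; exact: ltW.
  have s1 : 0 <= 1 - sign_step y by rewrite sE mulr_ge0//; lra.
  have sy : 1 - sign_step y <= (1 - y) * r.
    by rewrite sE ler_wpM2l ?subr_ge0// /r; lra.
  split.
    apply/andP; split; last by rewrite -subr_ge0.
    by rewrite (le_trans xy)// /sign_step; nra.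
  by rewrite (le_trans sy)// exprSr ler_wpM2r.
apply: (@squeeze_cvgr _ _ _ _ (fun n => 1 - r ^+ n) (cst 1)).
- apply: nearW => n; have [/andP[_ h] h'] := itP n.
  by rewrite h andbT lerBlDr -lerBlDl.
- rewrite -[X in _ --> X]subr0; apply: cvgB; first exact: cvg_cst.
  by apply: cvg_expr; rewrite ger0_norm.
- exact: cvg_cst.
Qed.

Lemma cvg_sign_step x : `|x| <= 1 ->
  iter n sign_step x @[n --> \oo] --> Num.sg x.
Proof.
rewrite ler_norml => /andP[x0 x1]; have [xlt|xgt|->] := ltgtP x 0.
- rewrite ltr0_sg// -[x]opprK.
  under eq_fun do rewrite iter_sign_stepN.
  by apply: cvgN; apply: cvg_sign_step_gt0; lra.
- by rewrite gtr0_sg//; exact: cvg_sign_step_gt0.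
- rewrite sgr0 [X in X @ _](_ : _ = cst 0); first exact: cvg_cst.
  by apply/funext; elim=> //= n ->; rewrite /sign_step !mul0r.
Qed.

End sign_iteration.

(** * The algebra of functions intertwined by a conjugation *)

Section intertwining.
Context d {T : measurableType d} {R : realType}.
Variables (mu : {measure set T -> \bar R}) (tau : T -> T).
Variables (C : L2 mu -> L2 mu).
Hypotheses (mtau : measurable_fun setT tau) (conjC : @conjugation R (L2 mu) C).
Implicit Types (g : T -> R) (u v w : L2 mu).

Lemma conjugationD u v : C (u + v) = C u + C v.
Proof. by case: conjC => Clin _ _; rewrite -[u]scale1r Clin conjC1 !scale1r. Qed.

Lemma conjugation0 : C 0 = 0.
Proof. by apply: (addrI (C 0)); rewrite -conjugationD !addr0. Qed.

Lemma conjugationZ a u : C (a *: u) = Num.conj a *: C u.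
Proof. by case: conjC => Clin _ _; rewrite -[a *: u]addr0 Clin conjugation0 addr0. Qed.

Lemma conjugationB u v : C (u - v) = C u - C v.
Proof.
by rewrite conjugationD -scaleN1r conjugationZ rmorphN1 scaleN1r.
Qed.

Lemma energy_conjugation u : energy mu (C u) = energy mu u.
Proof. by apply/L2_norm_eq; case: conjC. Qed.

Lemma energy_L2D u v :
  (energy mu (u + v : L2 mu)%R <= 2%:E * energy mu u + 2%:E * energy mu v)%E.
Proof.
have [mu_ mv] := (measurable_L2 u, measurable_L2 v).
rewrite (energy_ae_eq (measurable_L2 _) _ (L2_addE u v)); first exact: energyD.
exact: measurable_funD_complex.
Qed.

Lemma energy_L2_eq0 u : energy mu u = 0%E -> u = 0.
Proof.
move=> /(energy_eq0 (measurable_L2 u)) u0; apply/L2P.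
by apply: filterS2 u0 (L2_zeroE mu) => x + + _ => -> // ->.
Qed.

(* [g \o tau] is an honest composition: it may change on a non-null set when g
   is modified on a null set, so g is a function and not an a.e. class. *)
Definition intertwined g := [/\ measurable_fun setT g,
  exists M : R, forall x, `|g x| <= M
  & forall u v, v = (fun x => (g x)%:C%C * u x) %[ae mu] ->
      C v = (fun x => (g (tau x))%:C%C * C u x) %[ae mu]].

Lemma intertwined_L2 g u : intertwined g ->
  exists v, v = (fun x => (g x)%:C%C * u x) %[ae mu].
Proof. by move=> [mg [M gM] _]; exact: bounded_mul_L2 mg gM. Qed.

(** An antilinear map commutes with real scalars. *)
Lemma intertwined_cst a : intertwined (cst a).
Proof.
split=> [//||u v vE]; first by exists `|a|.
have -> : v = (a%:C)%C *: u.
  by apply/L2P; apply: filterS2 vE (L2_scaleE a%:C%C u) => x + + _ => -> // ->.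
have aE : Num.conj a%:C%C = a%:C%C := conjc_real a.
by rewrite conjugationZ aE; exact: L2_scaleE.
Qed.

Lemma intertwinedM g h : intertwined g -> intertwined h ->
  intertwined (fun x => g x * h x).
Proof.
move=> ig ih; have [mg [M gM] gP] := ig; have [mh [N hN] hP] := ih; split.
- exact: measurable_funM.
- by exists (M * N) => x; rewrite normrM ler_pM.
move=> u v vE; have [w wE] := intertwined_L2 u ih.
have {}vE : v = (fun x => (g x)%:C%C * w x) %[ae mu].
  by apply: filterS2 vE wE => x + + _ => -> // -> //; rewrite rmorphM mulrA.
apply: filterS2 (gP _ _ vE) (hP _ _ wE) => x + + _ => -> // -> //.
by rewrite rmorphM mulrA.
Qed.

Lemma intertwinedD g h : intertwined g -> intertwined h ->
  intertwined (fun x => g x + h x).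
Proof.
move=> ig ih; have [mg [M gM] gP] := ig; have [mh [N hN] hP] := ih; split.
- exact: measurable_funD.
- by exists (M + N) => x; rewrite (le_trans (ler_normD _ _))// lerD.
move=> u v vE; have [w wE] := intertwined_L2 u ig.
have [w' w'E] := intertwined_L2 u ih.
have -> : v = w + w'.
  apply/L2P; apply: filterS2 (filterI vE (L2_addE w w')) (filterI wE w'E) => x.
  by move=> [e1 e2] [e3 e4] _; rewrite e1// e2// e3// e4// rmorphD mulrDl.
rewrite conjugationD; apply: filterS3
  (L2_addE (C w) (C w')) (gP _ _ wE) (hP _ _ w'E).
by move=> x + + + _ => -> // -> // -> //; rewrite rmorphD mulrDl.
Qed.

Lemma intertwinedZ a g : intertwined g -> intertwined (fun x => a * g x).
Proof. by move=> ig; apply: (@intertwinedM (cst a)) => //; exact: intertwined_cst. Qed.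

(** Both $g_n u \to g u$ and $(g_n\circ\tau)\,Cu \to (g\circ\tau)\,Cu$ in $L^2$ by dominated
    convergence, and $C$ is isometric. Convergence at every point is assumed so that it survives
    composition with [tau], which may at this stage pull a null set back to a non-null one. *)
Lemma intertwined_lim (g_ : nat -> T -> R) g : (forall n, intertwined (g_ n)) ->
  (forall n x, `|g_ n x| <= 1) -> (forall x, g_ n x @[n --> \oo] --> g x) ->
  intertwined g.
Proof.
move=> ig g_1 gg.
have mg_ n : measurable_fun setT (g_ n) by have [] := ig n.
have mg : measurable_fun setT g.
  by apply: (measurable_fun_cvg mg_) => x _; exact: gg.
have g1 x : `|g x| <= 1.
  have ngg : `|g_ n x| @[n --> \oo] --> `|g x| by apply: cvg_norm; exact: gg.
  apply: (cvgr_to_le ngg).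
  by apply: nearW => n; exact: g_1.
split=> // [|u v vE]; first by exists 1.
have [w wE] :=
  bounded_mul_L2 (C u) (measurableT_comp mg mtau) (fun x => g1 (tau x)).
suff -> : C v = w by [].
apply/eqP; rewrite -subr_eq0; apply/eqP/energy_L2_eq0.
have le_n n : (energy mu (C v - w)%R <=
    2%:E * energy mu (fun x => (g_ n (tau x) - g (tau x))%:C%C * C u x)%R +
    2%:E * energy mu (fun x => (g_ n x - g x)%:C%C * u x)%R)%E.
  have [v_ v_E] := intertwined_L2 u (ig n); have [_ _ /(_ _ _ v_E) Cv_E] := ig n.
  (* The first summand is $(g_n\circ\tau - g\circ\tau)\,Cu$; the second has the same norm as $(g_n -
     g)u$. *)
  have -> : C v - w = (C v_ - w) + C (v - v_).
    by rewrite conjugationB [RHS]addrC addrA subrK.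
  apply: le_trans (energy_L2D _ _) _; rewrite energy_conjugation.
  have -> : energy mu (v - v_) = energy mu (v_ - v).
    by apply/L2_norm_eq; rewrite distrC.
  have BE (f h : L2 mu) : (f - h : L2 mu) = (fun x => f x - h x) %[ae mu].
    apply: filterS2 (L2_addE f (- h)) (L2_scaleE (-1) h) => x + + _ => -> //.
    by rewrite scaleN1r mulN1r => ->.
  rewrite le_eqVlt; apply/orP; left; apply/eqP.
  congr (_ * _ + _ * _)%E; apply: energy_ae_eq.
  - exact: measurable_L2.
  - apply: measurable_real_mul; last exact: measurable_L2.
    by apply: measurable_funB; exact: measurableT_comp.
  - apply: filterS3 (BE (C v_) w) Cv_E wE => x + + + _ => -> // -> // -> //.
    by rewrite rmorphB mulrBl.
  - exact: measurable_L2.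
  - apply: measurable_real_mul; last exact: measurable_L2.
    exact: measurable_funB.
  - apply: filterS3 (BE v_ v) v_E vE => x + + + _ => -> // -> // -> //.
    by rewrite rmorphB mulrBl.
apply/eqP; rewrite eq_le energy_ge0 andbT.
pose a n := energy mu (fun x => (g_ n (tau x) - g (tau x))%:C%C * C u x).
pose b n := energy mu (fun x => (g_ n x - g x)%:C%C * u x).
have a0 : a n @[n --> \oo] --> 0%E.
  apply: (@bounded_cvg_energy _ _ _ mu (fun n => g_ n \o tau) (g \o tau)) => //.
  - by move=> n; exact: measurableT_comp.
  - exact: measurableT_comp.
  - by move=> n x; exact: g_1.
  - by move=> x; exact: g1.
  - by move=> x; exact: gg.
have b0 : b n @[n --> \oo] --> 0%E by exact: bounded_cvg_energy.
have ab0 : (2%:E * a n + 2%:E * b n)%E @[n --> \oo] --> 0%E.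
  rewrite -[X in _ --> X]adde0 -(mule0 2%:E).
  by apply: cvgeD => //; apply: cvgeZl.
apply: (cvge_to_ge ab0); apply: nearW => n; exact: le_n.
Qed.

Lemma intertwined_sg g : intertwined g -> (forall x, `|g x| <= 1) ->
  intertwined (fun x => Num.sg (g x)).
Proof.
move=> ig g1; apply: (@intertwined_lim (fun n x => iter n sign_step (g x))).
- elim=> [//|n IH] /=; rewrite /sign_step.
  (* The step is rewritten with sums, products and real multiples only, the operations already known
     to preserve [intertwined]. *)
  rewrite (_ : (fun _ => _) = (fun x => iter n sign_step (g x) *
    (2^-1 * (3 + -1 * (iter n sign_step (g x) * iter n sign_step (g x)))))).
    apply: intertwinedM => //; apply: intertwinedZ; apply: intertwinedD.
      exact: intertwined_cst.
    by apply: intertwinedZ; exact: intertwinedM.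
  by apply/funext => x; rewrite -mulrA; congr (_ * _); rewrite mulrC mulN1r expr2.
- by move=> n x; exact: iter_sign_step_bound.
- by move=> x; exact: cvg_sign_step.
Qed.

(** With $s = \mathrm{sg}(g-a)$, the indicator of $\{g > a\}$ is $(s^2+s)/2$, which is 1 for $s=1$
    and 0 for $s=0$ or $s=-1$. *)
Lemma intertwined_gt g a : intertwined g ->
  intertwined (\1_[set x | a < g x] : T -> R).
Proof.
move=> ig; have [_ [M gM] _] := ig.
(* Scaling by [k] brings $g-a$ into $[-1,1]$ without changing its sign; the summand 1 keeps the
   denominator positive. *)
pose k := (`|M| + `|a| + 1)^-1.
have k0 : 0 < k by rewrite invr_gt0 ltr_wpDl// addr_ge0.
have isg : intertwined (fun x => Num.sg (k * (g x + - a))).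
  apply: intertwined_sg.
    by apply: intertwinedZ; apply: intertwinedD => //; exact: intertwined_cst.
  have N0 : 0 < `|M| + `|a| + 1 by rewrite ltr_wpDl// addr_ge0.
  move=> x; rewrite normrM (gtr0_norm k0) mulrC ler_pdivrMr// mul1r.
  rewrite (le_trans (ler_normB _ _))// ler_wpDr// lerD2r.
  exact: le_trans (gM x) (ler_norm _).
rewrite (_ : \1__ = (fun x => 2^-1 * (Num.sg (k * (g x + - a)) *
    Num.sg (k * (g x + - a)) + Num.sg (k * (g x + - a))))).
  by apply: intertwinedZ; apply: intertwinedD => //; exact: intertwinedM.
apply/funext => x; rewrite indicE sgrM (gtr0_sg k0) mul1r.
have [ag|ga] := ltP a (g x).
  by rewrite mem_set// gtr0_sg ?subr_gt0//= mul1r mulVf.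
rewrite memNset/=; last by apply/negP; rewrite -leNgt.
move: ga; rewrite le_eqVlt => /predU1P[->|ga].
  by rewrite subrr sgr0 mul0r addr0 mulr0.
by rewrite ltr0_sg ?subr_lt0// mulrNN mulr1 subrr mulr0.
Qed.

(** Complements correspond to $1-1_A$, intersections to products, and a countable union to the
    pointwise limit of the indicators of finite unions. *)
Lemma sigma_algebra_intertwined :
  sigma_algebra setT [set A | intertwined (\1_A : T -> R)].
Proof.
have iC A : intertwined (\1_A : T -> R) -> intertwined (\1_(~` A) : T -> R).
  move=> iA; rewrite (_ : \1_ _ = (fun x => 1 + -1 * \1_A x)).
    by apply: intertwinedD; [exact: intertwined_cst|exact: intertwinedZ].
  apply/funext => x; rewrite !indicE in_setC.
  by case: (_ \in _); rewrite /= ?mulr1 ?subrr ?mulr0 ?addr0.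
have iI A B : intertwined (\1_A : T -> R) -> intertwined (\1_B : T -> R) ->
    intertwined (\1_(A `&` B) : T -> R).
  move=> iA iB; rewrite (_ : \1_ _ = (fun x => \1_A x * \1_B x)).
    exact: intertwinedM.
  by apply/funext => x; rewrite indicI.
have i0 : intertwined (\1_set0 : T -> R).
  by rewrite indic0; exact: intertwined_cst.
split=> //= [A iA|F iF]; first by rewrite setTD; exact: iC.
have iU n : intertwined (\1_(\big[setU/set0]_(k < n) F k) : T -> R).
  elim: n => [|n IH]; first by rewrite big_ord0.
  rewrite big_ord_recr/= -[_ `|` _]setCK setCU.
  by apply: (iC); apply: iI; exact: iC.
apply: (intertwined_lim iU) => [n x|x].
  by rewrite indicE; case: (_ \in _); rewrite ?normr1 ?normr0 ?ler01.
have [[n _ Fnx]|Fx] := pselect ((\bigcup_n F n) x).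
  (* The partial union of index $k$ stops before $F_k$, so a point of $F_n$ belongs to it from index
     $n+1$ on. *)
  apply: cvg_near_cst; exists n.+1 => //= k /= nk.
  by rewrite !indicE !mem_set//; [exists n|rewrite -bigcup_mkord; exists n].
rewrite [X in X @ _](_ : _ = cst (\1_(\bigcup_n F n) x)); first exact: cvg_cst.
apply/funext => n; rewrite !indicE !memNset// => Fnx.
by apply: Fx; move: Fnx; rewrite -bigcup_mkord => -[k _ Fkx]; exists k.
Qed.

End intertwining.

(** * Consequences for [tau] when all measurable indicators are intertwined *)

Section intertwined_indicators.
Context d {T : measurableType d} {R : realType}.
Variables (P : probability T R) (tau : {mfun T >-> T}) (C : L2 P -> L2 P).
Hypothesis conjC : @conjugation R (L2 P) C.
Hypothesis intC : forall A, measurable A -> intertwined tau C (\1_A : T -> R).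

Let CK u : C (C u) = u. Proof. by case: conjC. Qed.

Let one_exists : exists u : L2 P, u = cst 1 %[ae P].
Proof.
apply: toL2_exists => //; rewrite /energy.
under eq_integral do rewrite Normc.normc1 expr1n.
by rewrite integral_cst// mul1e -ge0_fin_numE// fin_num_measure.
Qed.

(** For the constant $e = 1$, which is in $L^2$ because [P] is finite, $C(1_A e) =
    (1_A\circ\tau)\,Ce$. A second application of $C$ gives $1_A e = (1_A\circ\tau\circ\tau)\,e$. *)
Lemma intertwined_indic_comp2 A : measurable A ->
  {ae P, forall x, (A (tau (tau x)) <-> A x)}.
Proof.
move=> mA; have [e eE] := one_exists.
have mtA : measurable (tau @^-1` A).
  by rewrite -[X in measurable X]setTI; exact: measurable_funPT.
have [v vE] := intertwined_L2 e (intC mA); have [_ _ /(_ _ _ vE) CvE] := intC mA.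
have [_ _ /(_ (C e) (C v) CvE)] := intC mtA; rewrite !CK => vE'.
apply: filterS3 eE vE vE' => x + + + => -> // -> // /(_ I).
rewrite !mulr1 => /(@complexI R); rewrite !indicE.
have -> : (tau x \in tau @^-1` A) = (tau (tau x) \in A).
  by apply/idP/idP; rewrite !inE.
have [Ax|nAx] := pselect (A x); have [Ay|nAy] := pselect (A (tau (tau x))) => //.
  by rewrite mem_set// memNset//= => /eqP; rewrite oner_eq0.
by rewrite memNset// mem_set//= => /esym/eqP; rewrite oner_eq0.
Qed.

Let ae_notin_null A : measurable A -> {ae P, forall x, ~ A x} -> P A = 0%E.
Proof.
move=> mA [N [mN N0 AN]]; apply/eqP; rewrite eq_le measure_ge0 andbT -N0.
by apply: le_measure; rewrite ?inE// => x Ax; apply: AN => /=; apply.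
Qed.

(** If $A$ is null then $1_A\,Ce = 0$, and applying $C$ gives $(1_A\circ\tau)\,e = 0$. The test
    vector is $Ce$ so that the nowhere vanishing $e = 1$ appears after $C$. *)
Lemma intertwined_dominates : distribution P tau `<< P.
Proof.
apply/null_content_dominatesP => A mA A0; have [e eE] := one_exists.
have mtA : measurable (tau @^-1` A).
  by rewrite -[X in measurable X]setTI; exact: measurable_funPT.
have [v vE] := intertwined_L2 (C e) (intC mA).
have v0 : v = 0.
  apply/L2P; apply: filterS3 vE (L2_zeroE P) (_ : {ae P, forall x, ~ A x}).
    move=> x + + nAx _ => -> // -> //; rewrite indicE memNset//=.
    by rewrite mul0r.
  by exists A; split => // x /= /contrapT.
have [_ _ /(_ _ _ vE)] := intC mA; rewrite v0 (conjugation0 conjC) CK => zE.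
apply: ae_notin_null => //.
apply: filterS3 zE (L2_zeroE P) eE => x + + + Atx => /(_ I) + /(_ I) + /(_ I).
move=> -> + e1; rewrite e1 mulr1 indicE mem_set//=.
by move=> /(@complexI R)/eqP; rewrite oner_eq0.
Qed.

(** If $\tau^{-1}(A)$ is null then $C(1_A e) = (1_A\circ\tau)\,Ce = 0$, and $C$ is injective, so
    $1_A e = 0$. *)
Lemma intertwined_dominated : P `<< distribution P tau.
Proof.
apply/null_content_dominatesP => A mA A0; have [e eE] := one_exists.
have mtA : measurable (tau @^-1` A).
  by rewrite -[X in measurable X]setTI; exact: measurable_funPT.
have [v vE] := intertwined_L2 e (intC mA).
have [_ _ /(_ _ _ vE) CvE] := intC mA.
have Cv0 : C v = 0.
  apply/L2P; apply: filterS3 CvE (L2_zeroE P) (_ : {ae P, forall x, ~ A (tau x)}).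
    move=> x + + nAx _ => -> // -> //; rewrite indicE memNset//=.
    by rewrite mul0r.
  by exists (tau @^-1` A); split => // x /= /contrapT.
have v0 : v = 0 by rewrite -(CK v) Cv0 (conjugation0 conjC).
apply: ae_notin_null => //; move: vE; rewrite v0 => zE.
apply: filterS3 zE (L2_zeroE P) eE => x + + + Ax => /(_ I) + /(_ I) + /(_ I).
move=> -> + e1; rewrite e1 mulr1 indicE mem_set//=.
by move=> /(@complexI R)/eqP; rewrite oner_eq0.
Qed.

End intertwined_indicators.

(** * Density and weighted composition for a nonsingular a.e. involution *)

Section nonsingular_involution.
Context d {T : measurableType d} {R : realType}.
Variables (P : probability T R) (tau : {mfun T >-> T}).
Hypothesis tauP : distribution P tau `<< P.

(** Absolute continuity makes the preimage of the exceptional set null. This is what allows a.e.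
    identities to be evaluated at [tau x]. *)
Lemma ae_comp (Q : T -> Prop) :
  {ae P, forall x, Q x} -> {ae P, forall x, Q (tau x)}.
Proof.
move=> [N [mN N0 QN]]; exists (tau @^-1` N); split.
- by rewrite -[X in measurable X]setTI; exact: measurable_funPT.
- by move/null_content_dominatesP : tauP; apply.
- by move=> x /= Qx; exact: QN.
Qed.

(* Unlike ['d _ '/d _], this version of the density is nonnegative everywhere. *)
Let h := Radon_Nikodym_SigmaFinite.f (distribution P tau) P.

Let h_ge0 x : (0 <= h x)%E. Proof. exact: Radon_Nikodym_SigmaFinite.f_ge0. Qed.

Let h_fin x : h x \is a fin_num.
Proof. exact: Radon_Nikodym_SigmaFinite.f_fin_num. Qed.

Let mh : measurable_fun setT h.
Proof. exact: measurable_int (Radon_Nikodym_SigmaFinite.f_integrable tauP). Qed.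

Let hE : h = 'd (charge_of_finite_measure (distribution P tau)) '/d P %[ae P].
Proof. exact: ae_eq_Radon_Nikodym_SigmaFinite. Qed.

(** Both sides are the integral of [f] against the image measure. *)
Lemma ge0_integral_comp_density (f : T -> \bar R) : measurable_fun setT f ->
  (forall x, 0 <= f x)%E ->
  (\int[P]_x (f x * h x) = \int[P]_x f (tau x))%E.
Proof.
move=> mf f0; rewrite Radon_Nikodym_SigmaFinite.change_of_variables//.
exact: ge0_integral_distribution.
Qed.

Hypothesis tauK : {ae P, forall x, tau (tau x) = x}.

Let ae_integral_comp2 (f g : T -> \bar R) : measurable_fun setT f ->
  measurable_fun setT g -> (forall x, 0 <= f x)%E -> (forall x, 0 <= g x)%E ->
  (\int[P]_x (f (tau (tau x)) * g x) = \int[P]_x (f x * g x))%E.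
Proof.
move=> mf mg f0 g0; apply: ge0_ae_eq_integral => //.
- by apply: emeasurable_funM => //; do 2 apply: measurableT_comp => //.
- exact: emeasurable_funM.
- by move=> x _; rewrite mule_ge0.
- by move=> x _; rewrite mule_ge0.
- by apply: filterS tauK => x ->.
Qed.

(** Tested on a measurable $E$: a change of variables turns $\int 1_E\,(h\circ\tau)\,h$ into $\int
    (1_E\circ\tau)\,(h\circ\tau\circ\tau) = \int (1_E\circ\tau)\,h$, and a second one gives $\int
    1_E\circ\tau\circ\tau = P(E)$. *)
Let h_mul : {ae P, forall x, (h x * h (tau x) = 1)%E}.
Proof.
have mht : measurable_fun setT (h \o tau) by exact: measurableT_comp.
suff : ae_eq P setT (cst 1%E) (fun x => h x * h (tau x))%E.
  by apply: filterS => x /(_ I) <-.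
apply: integral_ae_eq => //.
- exact: finite_measure_integrable_cst.
- exact: emeasurable_funM.
move=> E _ mE; rewrite integral_cst// mul1e.
pose i x : \bar R := (\1_E x : R)%:E.
have mi : measurable_fun setT i by apply/measurable_EFinP.
have i0 x : (0 <= i x)%E by rewrite lee_fin.
rewrite integral_mkcond.
transitivity (\int[P]_x (i x * h (tau x) * h x))%E; last first.
  apply: eq_integral => x _; rewrite patchE /i indicE; case: ifPn => _.
    by rewrite mul1e muleC.
  by rewrite !mul0e.
rewrite ge0_integral_comp_density//; first last.
- by move=> x; rewrite mule_ge0.
- exact: emeasurable_funM.
have -> : (\int[P]_x (i (tau x) * h (tau (tau x))) =
    \int[P]_x (h (tau (tau x)) * i (tau x)))%E.
  by apply: eq_integral => x _; rewrite muleC.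
rewrite ae_integral_comp2//; last exact: measurableT_comp.
have -> : (\int[P]_x (h x * i (tau x)) = \int[P]_x (i (tau x) * h x))%E.
  by apply: eq_integral => x _; rewrite muleC.
rewrite (ge0_integral_comp_density (f := i \o tau))//=; last exact: measurableT_comp.
have := ae_integral_comp2 mi (measurable_cst 1%E) i0 (fun=> lee01).
under eq_integral do rewrite mule1.
under [X in _ = X -> _]eq_integral do rewrite mule1.
by move=> ->; rewrite integral_indic// setIT.
Qed.

Lemma Radon_Nikodym_involution :
  let g := 'd (charge_of_finite_measure (distribution P tau)) '/d P in
  {ae P, forall x, (g x * g (tau x) = 1)%E}.
Proof.
(* The two versions of the density must agree both at [x] and at [tau x]. *)
move=> g; apply: filterS3 h_mul hE (ae_comp hE) => x + /(_ I) e1 /(_ I) e2.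
by rewrite /g -e1 -e2.
Qed.

Let w x : R := Num.sqrt (fine (h x)).

Let W (f : T -> R[i]) x := (w x)%:C%C * Num.conj (f (tau x)).

Let mw : measurable_fun setT w.
Proof.
apply: measurableT_comp; first exact: continuous_measurable_fun (@sqrt_continuous R).
exact: measurableT_comp.
Qed.

Lemma measurable_conjc (f : T -> R[i]) : measurable_fun setT f ->
  measurable_fun setT (fun x => Num.conj (f x)).
Proof.
move=> /measurable_fun_complexP[mR mI]; apply/measurable_fun_complexP; split.
  rewrite (_ : _ \o _ = @complex.Re R \o f)//.
  by apply/funext => x /=; case: (f x).
rewrite (_ : _ \o _ = \- (@complex.Im R \o f)).
  exact: measurable_funN.
by apply/funext => x /=; case: (f x).
Qed.

Lemma normc_conj (z : R[i]) : Normc.normc (Num.conj z) = Normc.normc z.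
Proof. by case: z => a b /=; rewrite sqrrN. Qed.

Let mW f : measurable_fun setT f -> measurable_fun setT (W f).
Proof.
move=> mf; apply: measurable_real_mul => //; apply: measurable_conjc.
exact: measurableT_comp.
Qed.

(** The square root in the weight gives $|Wf|^2 = |f\circ\tau|^2 h$, whose integral is $\int
    |f\circ\tau\circ\tau|^2 = \int |f|^2$. *)
Let energyW f : measurable_fun setT f -> energy P (W f) = energy P f.
Proof.
move=> mf; have mF := measurable_normc2 mf.
have F0 x : (0 <= (Normc.normc (f x) ^+ 2)%:E)%E by rewrite lee_fin sqr_ge0.
have := ae_integral_comp2 mF (measurable_cst 1%E) F0 (fun=> lee01).
under eq_integral do rewrite mule1.
under [X in _ = X -> _]eq_integral do rewrite mule1.
rewrite -/(energy P f) => <-.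
rewrite -(ge0_integral_comp_density
  (f := fun x => (Normc.normc (f (tau x)) ^+ 2)%:E))//; last first.
  exact: (measurableT_comp mF).
apply: eq_integral => x _; rewrite /W Normc.normcM normc_real normc_conj exprMn.
rewrite real_normK ?num_real// sqr_sqrtr ?fine_ge0// mulrC EFinM fineK//.
Qed.

(** The weight $k = \sqrt h$ inherits $k\cdot(k\circ\tau) = 1$ from the density; with $\tau\circ\tau
    = \mathrm{id}$ a.e. this makes $C$ an involution. *)
Lemma weighted_conjugation : exists (C : L2 P -> L2 P) (k : T -> R),
  [/\ @conjugation R (L2 P) C,
      {ae P, forall x, k x * k (tau x) = 1}
    & forall u, C u = (fun x => (k x)%:C%C * Num.conj (u (tau x))) %[ae P]].
Proof.
have wK : {ae P, forall x, w x * w (tau x) = 1}.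
  apply: filterS h_mul => x; rewrite -(fineK (h_fin x)) -(fineK (h_fin (tau x))).
  move=> [hh]; rewrite /w -sqrtrM ?fine_ge0//.
  by rewrite hh sqrtr1.
have /choice[C CE] : forall u : L2 P, exists v : L2 P, v = W u %[ae P].
  move=> u; have mu_ := measurable_L2 u; apply: toL2_exists; first exact: mW.
  by rewrite energyW//; exact: energy_L2_lty.
exists C, w; split=> //; split.
- move=> a u v; apply/L2P.
  apply: filterS (filterI (filterI (CE (a *: u + v))
    (ae_comp (filterI (L2_addE (a *: u) v) (L2_scaleE a u))))
    (filterI (filterI (L2_addE (Num.conj a *: C u) (C v))
      (L2_scaleE (Num.conj a) (C u))) (filterI (CE u) (CE v)))).
  move=> x [[e3 [e4 e5]] [[e6 e7] [e8 e9]]] _.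
  by rewrite e3// e6// e7// e8// e9// /W e4// e5// rmorphD rmorphM mulrDr; ring.
- move=> u; apply/L2_norm_eq; rewrite -(energyW (measurable_L2 u)).
  exact: energy_ae_eq (measurable_L2 (C u)) (mW (measurable_L2 u)) (CE u).
- move=> u; apply/L2P.
  apply: filterS (filterI (filterI (CE (C u)) (ae_comp (CE u))) (filterI wK tauK)).
  move=> x [[e1 e2] [e3 e4]] _.
  rewrite e1// /W e2// /W rmorphM/= conjCK mulrA e4.
  have -> : Num.conj (w (tau x))%:C%C = (w (tau x))%:C%C :> R[i] := conjc_real _.
  by rewrite -rmorphM e3 mul1r.
Qed.

End nonsingular_involution.

(** * Conjugates of the bilateral shift on the circle *)

Section circle_orbit.
Context {R : realType}.
Implicit Types z : R[i].

Local Notation m := (@circle_lebesgue R).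

Let re (x : circle R) : R := complex.Re (circle_val x).
Let im (x : circle R) : R := complex.Im (circle_val x).

Let mre : measurable_fun setT re.
Proof. exact: measurableT_comp (@measurable_Re R) measurable_circle_val. Qed.

Let mim : measurable_fun setT im.
Proof. exact: measurableT_comp (@measurable_Im R) measurable_circle_val. Qed.

(** The sets with intertwined indicator form a sigma-algebra $G$ for which both coordinates are
    measurable. Hence the identity from the circle with $G$ to the circle with its Borel sets is
    measurable, that is, $G$ contains every Borel set. *)
Lemma intertwined_borel (tau : circle R -> circle R) (C : L2 m -> L2 m) :
  measurable_fun setT tau -> @conjugation R (L2 m) C ->
  intertwined tau C re -> intertwined tau C im ->
  forall A, measurable A -> intertwined tau C (\1_A : circle R -> R).
Proof.
move=> mtau conjC ire iim A mA.
pose G : set (set (circle R)) :=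
  [set A | intertwined tau C (\1_A : circle R -> R)].
have sG : sigma_algebra setT G by exact: sigma_algebra_intertwined.
pose f (x : g_sigma_algebraType G) : circle R := x.
have mgt (g : circle R -> R) : intertwined tau C g ->
    measurable_fun setT (g : g_sigma_algebraType G -> R).
  move=> ig; apply: (measurability _ (RGenOInfty.measurableE R)).
  move=> _ [_ [a ->] <-]; rewrite setTI; apply: sub_sigma_algebra.
  rewrite /G/= (_ : g @^-1` _ = [set x | a < g x]); first exact: intertwined_gt.
  by apply/seteqP; split=> x /=; rewrite in_itv/= andbT.
have mf : measurable_fun setT f.
  apply/measurable_fun_circleP/measurable_fun_complexP; split.
    exact: (mgt _ ire).
  exact: (mgt _ iim).
have := mf measurableT _ mA; rewrite setTI /measurable/=.
by rewrite (sigma_algebra_id sG).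
Qed.

Lemma real_eq_rat (a b : R) :
  (forall q : rat, (ratr q < a) <-> (ratr q < b)) -> a = b.
Proof.
have leP (x y : R) : (forall q : rat, ratr q < x -> ratr q < y) -> x <= y.
  move=> xy; rewrite leNgt; apply/negP => /rat_in_itvoo[q].
  by rewrite in_itv/= => /andP[yq /xy /(lt_trans yq)]; rewrite ltxx.
by move=> ab; apply/eqP; rewrite eq_le !leP// => q /ab.
Qed.

(** Each set $\{g > q\}$ with $q$ rational contributes one null set; countably many of them suffice
    to identify real values. *)
Lemma ae_comp_eq_real (tau : circle R -> circle R) (g : circle R -> R) :
  measurable_fun setT g ->
  (forall A, measurable A -> {ae m, forall x, (A (tau x) <-> A x)}) ->
  {ae m, forall x, g (tau x) = g x}.
Proof.
move=> mg AE.
(* The rationals are enumerated by [unpickle], because [ae_foralln] quantifies over [nat]. *)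
have : \forall x \ae m, forall n : nat,
    if unpickle n is Some q
    then (ratr (q : rat) < g (tau x)) <-> (ratr q < g x) else True.
  apply: ae_foralln => n; case: unpickle => [q|]; last exact: aeW.
  apply: (AE [set x | ratr q < g x]).
  rewrite [X in measurable X](_ : _ = setT `&` g @^-1` `]ratr q, +oo[).
    exact: mg.
  by apply/seteqP; split=> x /=; rewrite in_itv/= andbT => // -[].
by apply: filterS => x qx; apply: real_eq_rat => q;
  have := qx (pickle q); rewrite pickleK.
Qed.

Lemma ae_comp_eq_id (tau : circle R -> circle R) :
  (forall A, measurable A -> {ae m, forall x, (A (tau x) <-> A x)}) ->
  {ae m, forall x, tau x = x}.
Proof.
move=> AE; apply: filterS2 (ae_comp_eq_real mre AE) (ae_comp_eq_real mim AE).
move=> x; rewrite /re /im => rx ix; apply: circle_val_inj.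
by move: rx ix; case: (circle_val (tau x)) (circle_val x) => [a b] [c e] /= -> ->.
Qed.

Variable phi : {mfun circle R >-> circle R}.
Let tau : {mfun circle R >-> circle R} := @circle_conj R \o phi.

Lemma conj_circleV (x : circle R) : circle_val x * Num.conj (circle_val x) = 1.
Proof. by rewrite -normCK normr_circle expr1n. Qed.

Section orbit_intertwined.
Variable C : L2 m -> L2 m.
Hypothesis conjC : @conjugation R (L2 m) C.
Hypothesis CMC : C \o @bilateral_shift R \o C = mulop m phi.

Let CK u : C (C u) = u. Proof. by case: conjC. Qed.

Let shiftE (u : L2 m) :
  @bilateral_shift R u = (fun x => circle_val x * u x) %[ae m].
Proof. exact: mulopE. Qed.

Let C_shift (u : L2 m) : C (@bilateral_shift R u) = mulop m phi (C u).
Proof. by have := congr1 (fun f => f (C u)) CMC; rewrite /= CK. Qed.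

(** Here $w = M^{-1}u$, so $Cu = CMw = \phi\,Cw$, and multiplying by $\bar\phi$ isolates $Cw$. *)
Let backward_shift (u : L2 m) : exists2 w : L2 m,
  w = (fun x => Num.conj (circle_val x) * u x) %[ae m] &
  C w = (fun x => Num.conj (circle_val (phi x)) * C u x) %[ae m].
Proof.
exists (mulop m (@circle_conj R) u); first exact: mulopE.
set w := mulop _ _ _.
have uE : u = @bilateral_shift R w.
  apply/L2P; apply: filterS2 (shiftE w) (mulopE (@circle_conj R) u) => x.
  by move=> + + _ => -> // -> //; rewrite mulrA [X in X * _](conj_circleV x) mul1r.
apply: filterS (mulopE phi (C w)) => x + _; rewrite -C_shift -uE => -> //.
by rewrite mulrA [X in X * _]mulrC conj_circleV mul1r.
Qed.

Let C_shiftE (u : L2 m) :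
  C (@bilateral_shift R u) = (fun x => circle_val (phi x) * C u x) %[ae m].
Proof. by rewrite C_shift; exact: mulopE. Qed.

(** Here $gu = aMu + bM^{-1}u$, which $C$ sends to $(\bar a\phi + \bar b\bar\phi)\,Cu$. The factor
    is the conjugate of $g\circ\tau$, hence $g\circ\tau$ itself as $g$ is real. *)
Lemma intertwined_trig (a b : R[i]) (g : circle R -> R) :
  measurable_fun setT g -> (forall x, `|g x| <= 1) ->
  (forall x : circle R,
    (g x)%:C%C = a * circle_val x + b * Num.conj (circle_val x)) ->
  intertwined tau C g.
Proof.
move=> mg g1 gE; split=> // [|u v vE]; first by exists 1.
have [w wE CwE] := backward_shift u.
have gtE x : (g (tau x))%:C%C = Num.conj a * circle_val (phi x) +
    Num.conj b * Num.conj (circle_val (phi x)).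
  have -> : (g (tau x))%:C%C = Num.conj (g (tau x))%:C%C :> R[i].
    exact/esym/conjc_real.
  by rewrite gE rmorphD !rmorphM/= !conjCK.
have -> : v = a *: @bilateral_shift R u + b *: w.
  apply/L2P; apply: filterS (filterI (filterI vE wE) (filterI (shiftE u)
    (filterI (L2_addE (a *: @bilateral_shift R u) (b *: w))
    (filterI (L2_scaleE a (@bilateral_shift R u)) (L2_scaleE b w))))).
  move=> x [[e1 e2] [e3 [e4 [e5 e6]]]] _.
  by rewrite e1// e4// e5// e6// e2// e3// gE mulrDl !mulrA.
rewrite (conjugationD conjC) !(conjugationZ conjC).
set Mu := @bilateral_shift R u.
apply: filterS (filterI CwE (filterI (C_shiftE u)
  (filterI (L2_addE (Num.conj a *: C Mu) (Num.conj b *: C w))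
    (filterI (L2_scaleE (Num.conj a) (C Mu)) (L2_scaleE (Num.conj b) (C w)))))).
move=> x [e2 [e3 [e4 [e5 e6]]]] _.
by rewrite e4// e5// e6// e2// e3// gtE mulrDl !mulrA.
Qed.

Lemma orbit_intertwined A : measurable A ->
  intertwined tau C (\1_A : circle R -> R).
Proof.
apply: intertwined_borel => //.
(* $\mathrm{Re}\,z = (z+\bar z)/2$ on the circle. *)
- apply: (@intertwined_trig (2^-1)%:C%C (2^-1)%:C%C) => // x.
    by rewrite -lecR (le_trans (normc_ge_Re _))// normr_circle.
  rewrite /re; case: (circle_val x) => c e.
  by apply/eqP; rewrite eq_complex/=; apply/andP; split; apply/eqP; field.
(* $\mathrm{Im}\,z = (z-\bar z)/(2i)$, with coefficients $-i/2$ and $i/2$. *)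
- apply: (@intertwined_trig (0 +i* - 2^-1)%C (0 +i* 2^-1)%C) => // x.
    by rewrite -lecR (le_trans (normc_ge_Im _))// normr_circle.
  rewrite /im; case: (circle_val x) => c e.
  by apply/eqP; rewrite eq_complex/=; apply/andP; split; apply/eqP; field.
Qed.

End orbit_intertwined.

Lemma orbit_necessary :
  conjugate_orbit (@bilateral_shift R) (mulop m phi) ->
  {ae m, forall x, tau (tau x) = x} /\
  (distribution m tau `<< m /\ m `<< distribution m tau).
Proof.
move=> [C conjC CMC]; have intC := orbit_intertwined conjC CMC.
split; last split.
- apply: (@ae_comp_eq_id (tau \o tau)) => A mA.
  exact: (intertwined_indic_comp2 conjC intC).
- exact: (intertwined_dominates conjC intC).
- exact: (intertwined_dominated conjC intC).
Qed.

(** For the weighted conjugation, $CMCu = k\,\overline{\tau}\,(k\circ\tau)\,(u\circ\tau\circ\tau)$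
    a.e., which reduces to $\phi u$ because $\overline{\tau} = \phi$ and $k\cdot(k\circ\tau) =
    1$. *)
Lemma orbit_sufficient :
  {ae m, forall x, tau (tau x) = x} -> distribution m tau `<< m ->
  conjugate_orbit (@bilateral_shift R) (mulop m phi).
Proof.
move=> tauK numu; have [C [k [conjC kK CE]]] := weighted_conjugation numu tauK.
exists C => //; apply/funext => u /=; apply/L2P.
apply: filterS (filterI
  (filterI (CE (@bilateral_shift R (C u))) (ae_comp numu (CE u)))
  (filterI (filterI kK tauK) (filterI (mulopE phi u)
  (ae_comp numu (mulopE idfun (C u)))))).
move=> x [[e1 e2] [[e3 e4] [e5 e6]]] _.
rewrite e1// e6// e2// e5// e4.
have kR : Num.conj (k (tau x))%:C%C = (k (tau x))%:C%C :> R[i] := conjc_real _.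
rewrite !rmorphM/= conjCK kR conjCK.
rewrite (_ : _ * _ = ((k x * k (tau x))%:C)%C * (circle_val (phi x) * u x)).
  by rewrite e3 mul1r.
by rewrite rmorphM/=; ring.
Qed.

End circle_orbit.

Theorem theorem4p15 (R : realType) (phi : {mfun circle R >-> circle R}) :
  let m := @circle_lebesgue R in
  let phibar := @circle_conj R \o phi in
  let nu := distribution m phibar in
  let h := 'd (charge_of_finite_measure nu) '/d m in
  conjugate_orbit (@bilateral_shift R) (mulop m phi) <->
  [/\ {ae m, forall x, phibar (phibar x) = x},
      nu `<< m /\ m `<< nu
    & {ae m, forall x, (h x * h (phibar x) = 1)%E}].
Proof.
move=> m phibar nu h; split=> [/orbit_necessary[tauK [numu munu]]|].
  by split=> //; exact: Radon_Nikodym_involution numu tauK.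
by move=> [tauK [numu _] _]; exact: orbit_sufficient.
Qed.
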